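(* Let $\Phi:\mathbb{M}_n\to\mathbb{M}_l$ and $\Psi:\mathbb{M}_m\to\mathbb{M}_l$ be positive linear maps. Let $f\in\mathrm{OM}_{+,1}$. Let $\varphi_0$ and $\varphi_1$ be arbitrary non-negative functions on $[0,\infty)$ and define the functions $\varphi:=\varphi_0\,\sigma_f\,\varphi_1$ and $\widetilde\varphi:=\varphi_0\,\sigma_f^*\,\varphi_1$ on $[0,\infty)$. Then for every $A\in\mathbb{M}_n^+$ and $B\in\mathbb{M}_m^+$, $$\bigl\|\Phi(\widetilde\varphi(A))^{1/2}\Psi(\varphi(B))\Phi(\widetilde\varphi(A))^{1/2}\bigr\|_\infty\le\max\Bigl\{\bigl\|\Phi(\varphi_0(A))^{1/2}\Psi(\varphi_0(B))\Phi(\varphi_0(A))^{1/2}\bigr\|_\infty,\ \bigl\|\Phi(\varphi_1(A))^{1/2}\Psi(\varphi_1(B))\Phi(\varphi_1(A))^{1/2}\bigr\|_\infty\Bigr\}.$$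
   Context: $\mathbb{M}_n$ is the algebra of $n\times n$ complex matrices and $\mathbb{M}_n^+$ the set of positive semidefinite matrices in $\mathbb{M}_n$; $\|\cdot\|_\infty$ is the operator norm. A linear map $\Phi:\mathbb{M}_n\to\mathbb{M}_l$ is positive if $\Phi(A)\in\mathbb{M}_l^+$ for all $A\in\mathbb{M}_n^+$. For a function $\varphi$ on $[0,\infty)$ and $A\in\mathbb{M}_n^+$, $\varphi(A)$ is defined by functional calculus (applying $\varphi$ to the eigenvalues). $\mathrm{OM}_{+,1}$ is the set of non-negative operator monotone functions $f$ on $[0,\infty)$ with $f(1)=1$. For $f\in\mathrm{OM}_{+,1}$, $f^*\in\mathrm{OM}_{+,1}$ is defined by $f^*(x):=f(x^{-1})^{-1}$ for $x>0$ (extended to $x=0$ by the limit $x\searrow0$). $\sigma_f$ is the operator mean associated with $f$ and its adjoint $\sigma_f^*$ is the operator mean associated with $f^*$. For non-negative functions $\varphi_0,\varphi_1$ on $[0,\infty)$, $$(\varphi_0\,\sigma_f\,\varphi_1)(x):=\lim_{\varepsilon\searrow0}(\varphi_0(x)+\varepsilon)\,f\Bigl(\frac{\varphi_1(x)+\varepsilon}{\varphi_0(x)+\varepsilon}\Bigr),\qquad x\in[0,\infty),$$ and $\varphi_0\,\sigma_f^*\,\varphi_1$ is defined by the same formula with $f^*$ in place of $f$. *)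

(* Defs.v *)
From HB Require Import structures.
From mathcomp Require Import all_boot all_order all_algebra.
From mathcomp Require Import all_classical all_reals all_analysis.
From mathcomp.real_closed Require Import complex.

Set Implicit Arguments.
Unset Strict Implicit.
Unset Printing Implicit Defensive.

Import Order.TTheory GRing.Theory Num.Theory.
Import numFieldNormedType.Exports.

Local Open Scope classical_set_scope.
Local Open Scope ring_scope.
Local Open Scope complex_scope.
Local Open Scope sesquilinear_scope.

(* The real numbers are an arbitrary R : realType, the complex numbers R[i].
   Functions on [0, +oo[ are total functions R -> R of which only the values
   at x >= 0 are ever constrained or used. *)

Definition psdmx (R : realType) (n : nat) (A : 'M[R[i]]_n) : Prop :=
  A \is hermsymmx /\ forall v : 'cV[R[i]]_n, 0 <= (v ^t* *m A *m v) 0 0.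

Definition loewner_le (R : realType) (n : nat) (A B : 'M[R[i]]_n) : Prop :=
  psdmx (B - A).

Definition positive_map (R : realType) (n l : nat)
    (Phi : 'M[R[i]]_n -> 'M[R[i]]_l) : Prop :=
  forall A, psdmx A -> psdmx (Phi A).

(* Only used on Hermitian matrices, where the eigenvalues collected in
   [spectral_diag A] are real (so that taking real parts loses nothing) and
   A = invmx (spectralmx A) *m diag_mx (spectral_diag A) *m spectralmx A. *)
Definition funcalc (R : realType) (n : nat) (phi : R -> R)
    (A : 'M[R[i]]_n) : 'M[R[i]]_n :=
  invmx (spectralmx A)
  *m diag_mx (map_mx (fun z => (phi (complex.Re z))%:C) (spectral_diag A))
  *m spectralmx A.

Definition sqrtmx (R : realType) (n : nat) (A : 'M[R[i]]_n) : 'M[R[i]]_n :=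
  funcalc Num.sqrt A.

Definition l2norm (R : realType) (n : nat) (v : 'cV[R[i]]_n) : R :=
  Num.sqrt (\sum_i (ComplexField.Normc.normc (v i 0)) ^+ 2).

(* The supremum is over the closed unit ball rather than the unit sphere, so
   that the set is nonempty also in dimension 0. *)
Definition opnorm (R : realType) (n : nat) (A : 'M[R[i]]_n) : R :=
  sup [set l2norm (A *m v) | v in [set v : 'cV[R[i]]_n | l2norm v <= 1]].

Definition operator_monotone (R : realType) (f : R -> R) : Prop :=
  forall (k : nat) (A B : 'M[R[i]]_k),
    psdmx A -> psdmx B -> loewner_le A B ->
    loewner_le (funcalc f A) (funcalc f B).

(* OM_{+,1}. Continuity at 0 is not required; neither the adjoint nor the mean
   below depends on the value of f at 0. *)
Definition OM1 (R : realType) (f : R -> R) : Prop :=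
  [/\ forall x, 0 <= x -> 0 <= f x, operator_monotone f & f 1 = 1].

Definition adjoint_fun (R : realType) (f : R -> R) (x : R) : R :=
  if 0 < x then (f x^-1)^-1 else lim ((f y^-1)^-1 @[y --> (0 : R)^'+]).

(* phi0 sigma_f phi1; for f in OM_{+,1} the expression under the limit is
   nonincreasing as eps decreases to 0, and nonnegative, so the limit exists. *)
Definition mean_fun (R : realType) (f phi0 phi1 : R -> R) (x : R) : R :=
  lim ((phi0 x + eps) * f ((phi1 x + eps) / (phi0 x + eps))
       @[eps --> (0 : R)^'+]).

(* Main.v *)
(* Write E_i and F_j for the images under Phi and Psi of the spectral projections
   of A and B.  Then Phi (phi0 A) = X0 = sum_i a_i E_i, Psi (phi0 B) = Y0 =
   sum_j c_j F_j, and likewise X1, Y1 for phi1 with weights b_i, d_j.  After a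
   small perturbation everything is positive definite, and an upper bound g of
   the right-hand side means Y0 <= g X0^-1 and Y1 <= g X1^-1.  With
   S = X0^(1/2), Q = S^-1 X1 S^-1 and G = f(Q^-1) = fa(Q)^-1, where fa is the
   adjoint of f, the operator Jensen inequality gives both
     S^-1 Phi(phit A) S^-1 <= fa(Q) = G^-1   and   S Psi(phi B) S <= g G,
   so that Psi(phi B) <= g H^-1 and Phi(phit A) <= H for H = S G^-1 S.

   Jensen's inequality for an operator monotone f follows Hansen's dilation
   argument: for an isometry V and T >= 0 with (1 + d) V^t T V <= Q one has
   T <= S := V Q V^t + c (1 - V V^t) for large c; as S V = V Q, functional calculus
   gives V^t f(T) V <= V^t f(S) V = f(Q).

   Perturbing needs that (a + e) f((b + e) / (a + e)) increases with e, which
   amounts to the monotonicity of f and of t / f(t); the latter is the 1 x 1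
   case of Jensen's inequality. *)
Require Import Defs.
From HB Require Import structures.
From mathcomp Require Import all_boot all_order all_algebra.
From mathcomp Require Import all_classical all_reals all_analysis.
From mathcomp.real_closed Require Import complex.
From mathcomp Require Import ring lra.

Set Implicit Arguments.
Unset Strict Implicit.
Unset Printing Implicit Defensive.

Import Order.TTheory GRing.Theory Num.Theory.
Import numFieldNormedType.Exports.

Local Open Scope ring_scope.
Local Open Scope complex_scope.

Local Notation "A ^t*" := (map_mx Num.conj A^T) (at level 30).
Local Notation "A ⊑ B" := (loewner_le A B) (at level 70).

(** * Positive semidefinite matrices and the Loewner order *)

Section Loewner.
Context {R : realType}.
Local Notation C := R[i].

Lemma mxDE m n (A B : 'M[C]_(m, n)) i j : (A + B) i j = A i j + B i j.
Proof. by rewrite mxE. Qed.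

Lemma mxNE m n (A : 'M[C]_(m, n)) i j : (- A) i j = - A i j.
Proof. by rewrite mxE. Qed.

Lemma mxZE m n (a : C) (A : 'M[C]_(m, n)) i j : (a *: A) i j = a * A i j.
Proof. by rewrite mxE. Qed.

Lemma ctmxM m n p (A : 'M[C]_(m, n)) (B : 'M[C]_(n, p)) :
  (A *m B)^t* = B^t* *m A^t*.
Proof. by rewrite trmx_mul map_mxM. Qed.

Lemma ctmxD m n (A B : 'M[C]_(m, n)) : (A + B)^t* = A^t* + B^t*.
Proof. by rewrite linearD map_mxD. Qed.

Lemma ctmxB m n (A B : 'M[C]_(m, n)) : (A - B)^t* = A^t* - B^t*.
Proof. by rewrite linearB map_mxB. Qed.

Lemma ctmxZ m n (a : C) (A : 'M[C]_(m, n)) : (a *: A)^t* = Num.conj a *: A^t*.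
Proof. by rewrite linearZ map_mxZ. Qed.

Lemma ctmxK m n (A : 'M[C]_(m, n)) : A^t*^t* = A.
Proof. exact: trmxCK. Qed.

Lemma ctmx1 n : (1%:M : 'M[C]_n)^t* = 1%:M.
Proof. by rewrite trmx1 map_mx1. Qed.

Lemma conj_realC (r : R) : Num.conj (r%:C : C) = r%:C.
Proof. exact: conjc_real. Qed.

Lemma ctmx_scalar n (r : R) : (r%:C%:M : 'M[C]_n)^t* = r%:C%:M.
Proof. by rewrite tr_scalar_mx map_scalar_mx; congr (_%:M); exact: conj_realC. Qed.

Lemma psd_herm n (A : 'M[C]_n) : psdmx A -> A^t* = A.
Proof.
by case=> /is_hermitianmxP + _; rewrite expr0 scale1r => {2}->.
Qed.

Lemma psdI n (A : 'M[C]_n) : A^t* = A ->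
  (forall v : 'cV[C]_n, 0 <= (v^t* *m A *m v) 0 0) -> psdmx A.
Proof.
by move=> hA A0; split=> //; apply/is_hermitianmxP; rewrite expr0 scale1r hA.
Qed.

Lemma psd0 n : psdmx (0 : 'M[C]_n).
Proof.
apply: psdI => [|v]; first by rewrite trmx0 map_mx0.
by rewrite mulmx0 mul0mx mxE.
Qed.

Lemma psdD n (A B : 'M[C]_n) : psdmx A -> psdmx B -> psdmx (A + B).
Proof.
move=> hA hB; apply: psdI => [|v]; first by rewrite ctmxD !psd_herm.
by rewrite mulmxDr mulmxDl mxE addr_ge0 //; [case: hA|case: hB].
Qed.

Lemma psdZ n (a : C) (A : 'M[C]_n) : 0 <= a -> psdmx A -> psdmx (a *: A).
Proof.
move=> a0 hA; apply: psdI => [|v].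
  by rewrite ctmxZ psd_herm // geC0_conj.
by rewrite -scalemxAr -scalemxAl mxE mulr_ge0 //; case: hA.
Qed.

Lemma psd_sum n (I : finType) (F : I -> 'M[C]_n) :
  (forall i, psdmx (F i)) -> psdmx (\sum_i F i).
Proof.
by move=> hF; elim/big_ind: _ => [|x y hx hy|i _];
  [exact: psd0|exact: psdD hx hy|exact: hF].
Qed.

Lemma psd_conj n p (A : 'M[C]_n) (V : 'M[C]_(n, p)) :
  psdmx A -> psdmx (V^t* *m A *m V).
Proof.
move=> hA; apply: psdI => [|v]; first by rewrite !ctmxM ctmxK psd_herm // mulmxA.
by have := hA.2 (V *m v); rewrite ctmxM !mulmxA.
Qed.

Lemma psd_scalar n (r : R) : 0 <= r -> psdmx (r%:C%:M : 'M[C]_n).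
Proof.
move=> r0; rewrite -scalemx1; apply: psdZ; first by rewrite ler0c.
apply: psdI => [|v]; first exact: ctmx1.
rewrite mulmx1 mxE sumr_ge0 // => i _; rewrite !mxE mulrC.
exact: mul_conjC_ge0.
Qed.

Lemma psd_gram n p (V : 'M[C]_(n, p)) : psdmx (V^t* *m V).
Proof.
by have := psd_conj V (psd_scalar n ler01); rewrite mulmx1.
Qed.

Lemma loewner_refl n (A : 'M[C]_n) : A ⊑ A.
Proof. by rewrite /loewner_le subrr; exact: psd0. Qed.

Lemma loewner_trans n (B A D : 'M[C]_n) : A ⊑ B -> B ⊑ D -> A ⊑ D.
Proof.
rewrite /loewner_le => h1 h2.
have -> : D - A = (D - B) + (B - A) by rewrite addrA subrK.
exact: psdD h2 h1.
Qed.

Lemma loewnerD n (A B D E : 'M[C]_n) : A ⊑ B -> D ⊑ E -> A + D ⊑ B + E.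
Proof.
by rewrite /loewner_le => h1 h2; rewrite opprD addrACA; exact: psdD h1 h2.
Qed.

Lemma loewnerZ n (a : C) (A B : 'M[C]_n) : 0 <= a -> A ⊑ B -> a *: A ⊑ a *: B.
Proof. by rewrite /loewner_le -scalerBr; exact: psdZ. Qed.

Lemma loewner_conj n p (A B : 'M[C]_n) (V : 'M[C]_(n, p)) :
  A ⊑ B -> V^t* *m A *m V ⊑ V^t* *m B *m V.
Proof.
by rewrite /loewner_le -mulmxBl -mulmxBr; exact: psd_conj.
Qed.

Lemma loewner_conjH n (A B S : 'M[C]_n) : S^t* = S ->
  A ⊑ B -> S *m A *m S ⊑ S *m B *m S.
Proof. by move=> hS /(loewner_conj S); rewrite hS. Qed.

Lemma psd_conjH n (A S : 'M[C]_n) : S^t* = S ->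
  psdmx A -> psdmx (S *m A *m S).
Proof. by move=> hS /(psd_conj S); rewrite hS. Qed.

Lemma loewner_ge0 n (A : 'M[C]_n) : 0 ⊑ A = psdmx A.
Proof. by rewrite /loewner_le subr0. Qed.

Lemma loewner_psd n (A B : 'M[C]_n) : psdmx A -> A ⊑ B -> psdmx B.
Proof. by rewrite -!loewner_ge0; exact: loewner_trans. Qed.

Lemma loewner_scalar n (r s : R) : r <= s -> (r%:C%:M : 'M[C]_n) ⊑ s%:C%:M.
Proof.
by move=> rs; rewrite /loewner_le -raddfB/= -raddfB; apply: psd_scalar; rewrite subr_ge0.
Qed.

End Loewner.

(** [ring] works on the commuting entries, so matrix products are generalized to variables
    beforehand; the identity left over is linear in them. *)
Ltac mx_linear := apply/matrixP => ? ?; rewrite ?(mxDE, mxNE, mxZE); ring.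

(** * Functional calculus of Hermitian matrices *)

Section FunctionalCalculus.
Context {R : realType}.
Local Notation C := R[i].

Definition rdiag n (d : 'rV[R]_n) : 'M[C]_n := diag_mx (map_mx (real_complex R) d).

Definition specvals n (A : 'M[C]_n) : 'rV[R]_n :=
  map_mx (@complex.Re R) (spectral_diag A).

Lemma spectral_ctmxM n (A : 'M[C]_n) : (spectralmx A)^t* *m spectralmx A = 1%:M.
Proof. by apply: mulmx1C; apply/unitarymxP; exact: spectral_unitarymx. Qed.

Lemma spectral_mulct n (A : 'M[C]_n) : spectralmx A *m (spectralmx A)^t* = 1%:M.
Proof. by apply/unitarymxP; exact: spectral_unitarymx. Qed.

Lemma funcalcE n (phi : R -> R) (A : 'M[C]_n) :
  funcalc phi A =
  (spectralmx A)^t* *m rdiag (map_mx phi (specvals A)) *m spectralmx A.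
Proof.
rewrite /funcalc (invmx_unitary (spectral_unitarymx A)) /rdiag.
suff -> : map_mx (real_complex R) (map_mx phi (specvals A)) =
  map_mx (fun z => (phi (complex.Re z))%:C) (spectral_diag A) by [].
by apply/matrixP => i j; rewrite !mxE.
Qed.

Lemma spectralE n (A : 'M[C]_n) : A^t* = A ->
  A = (spectralmx A)^t* *m rdiag (specvals A) *m spectralmx A.
Proof.
move=> hA; have hs : A \is hermsymmx.
  by apply/is_hermitianmxP; rewrite expr0 scale1r hA.
have /hermitian_normalmx/orthomx_spectralP {1}-> := hs.
rewrite (invmx_unitary (spectral_unitarymx A)) /rdiag.
suff -> : map_mx (real_complex R) (specvals A) = spectral_diag A by [].
apply/matrixP => i j; rewrite !mxE RRe_real //.
by have /mxOverP := hermitian_spectral_diag_real hs; apply.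
Qed.

Lemma ctmx_rdiag n (d : 'rV[R]_n) : (rdiag d)^t* = rdiag d.
Proof.
rewrite /rdiag tr_diag_mx map_diag_mx; congr diag_mx.
by apply/matrixP => i j; rewrite !mxE; exact: conj_realC.
Qed.

(** Entrywise the hypothesis reads (d_i - e_j) M_ij = 0: either M_ij vanishes or d_i = e_j, and in
    both cases an arbitrary [phi] may be applied. *)
Lemma rdiag_intertwine n p (phi : R -> R) (d : 'rV[R]_n) (e : 'rV[R]_p)
    (M : 'M[C]_(n, p)) :
  rdiag d *m M = M *m rdiag e ->
  rdiag (map_mx phi d) *m M = M *m rdiag (map_mx phi e).
Proof.
move=> /matrixP h; apply/matrixP => i j; have := h i j.
rewrite /rdiag !mul_diag_mx !mul_mx_diag !mxE mulrC => /eqP.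
rewrite -subr_eq0 -mulrBr mulf_eq0 => /orP[/eqP->|]; first by rewrite mulr0 mul0r.
by rewrite subr_eq0 => /eqP/complexI ->; rewrite mulrC.
Qed.

(** In the two eigenbases [V] becomes U V W^t, which intertwines diagonal matrices. [V] may be
    rectangular, as is the isometry in Jensen's inequality. *)
Lemma funcalc_intertwine n p (phi : R -> R) (A : 'M[C]_n) (B : 'M[C]_p)
    (V : 'M[C]_(n, p)) :
  A^t* = A -> B^t* = B -> A *m V = V *m B ->
  funcalc phi A *m V = V *m funcalc phi B.
Proof.
move=> /spectralE hA /spectralE hB h; rewrite !funcalcE.
set U := spectralmx A in hA *; set W := spectralmx B in hB *.
have h1 : rdiag (specvals A) *m (U *m V *m W^t*) = U *m V *m W^t* *m rdiag (specvals B).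
  have := congr1 (fun X => U *m X *m W^t*) h; rewrite {1}hA {1}hB !mulmxA.
  by rewrite spectral_mulct mul1mx -!mulmxA spectral_mulct mulmx1 !mulmxA.
have := congr1 (fun X => U^t* *m X *m W) (rdiag_intertwine phi h1).
rewrite !mulmxA spectral_ctmxM mul1mx -!mulmxA spectral_ctmxM mulmx1 !mulmxA.
exact.
Qed.

(** The result is independent of the diagonalization: if W is the eigenbasis picked by [spectralmx],
    then W U^t intertwines the two lists of eigenvalues. *)
Lemma funcalc_unitary n (phi : R -> R) (U : 'M[C]_n) (d : 'rV[R]_n) :
  U^t* *m U = 1%:M ->
  funcalc phi (U^t* *m rdiag d *m U) = U^t* *m rdiag (map_mx phi d) *m U.
Proof.
move=> hU; have hU' := mulmx1C hU; set A := _ *m _ *m U.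
have /spectralE hA : A^t* = A by rewrite /A !ctmxM ctmxK ctmx_rdiag mulmxA.
rewrite funcalcE; set W := spectralmx A in hA *.
have h1 : rdiag (specvals A) *m (W *m U^t*) = W *m U^t* *m rdiag d.
  have := congr1 (fun X => W *m X *m U^t*) hA; rewrite {1}/A !mulmxA.
  by rewrite spectral_mulct mul1mx -!mulmxA hU' mulmx1 !mulmxA.
have := congr1 (fun X => W^t* *m X *m U) (rdiag_intertwine phi h1).
rewrite !mulmxA spectral_ctmxM mul1mx -!mulmxA hU mulmx1 !mulmxA.
exact.
Qed.

Lemma ctmx_funcalc n (phi : R -> R) (A : 'M[C]_n) :
  (funcalc phi A)^t* = funcalc phi A.
Proof. by rewrite funcalcE !ctmxM ctmxK ctmx_rdiag mulmxA. Qed.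

Lemma funcalc_rdiag n (phi : R -> R) (d : 'rV[R]_n) :
  funcalc phi (rdiag d) = rdiag (map_mx phi d).
Proof.
have := @funcalc_unitary n phi 1%:M d; rewrite ctmx1 !mul1mx !mulmx1; exact.
Qed.

Lemma rdiag_const n (r : R) : rdiag (const_mx r : 'rV[R]_n) = r%:C%:M.
Proof. by rewrite /rdiag map_const_mx diag_const_mx. Qed.

Lemma funcalc_scalar n (phi : R -> R) (r : R) :
  funcalc phi (r%:C%:M : 'M[C]_n) = (phi r)%:C%:M.
Proof. by rewrite -!rdiag_const funcalc_rdiag map_const_mx. Qed.

Lemma funcalc_comp n (phi psi : R -> R) (A : 'M[C]_n) :
  funcalc phi (funcalc psi A) = funcalc (phi \o psi) A.
Proof.
rewrite (funcalcE psi) (funcalc_unitary _ _ (spectral_ctmxM A)) funcalcE.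
by rewrite -map_mx_comp.
Qed.

Lemma funcalc_id n (A : 'M[C]_n) : A^t* = A -> funcalc id A = A.
Proof.
move=> hA; rewrite funcalcE (_ : map_mx id _ = specvals A) -?spectralE //.
by apply/matrixP => i j; rewrite !mxE.
Qed.

Lemma rdiagM n (d e : 'rV[R]_n) :
  rdiag d *m rdiag e = rdiag (\row_j (d 0 j * e 0 j)).
Proof.
rewrite /rdiag mulmx_diag; apply: congr1; apply/matrixP => i j.
by rewrite !mxE rmorphM.
Qed.

Lemma funcalcM n (phi psi : R -> R) (A : 'M[C]_n) :
  funcalc phi A *m funcalc psi A = funcalc (fun x => phi x * psi x) A.
Proof.
rewrite !funcalcE -!mulmxA (mulmxA (spectralmx A)) spectral_mulct mul1mx.
rewrite (mulmxA (rdiag _)) rdiagM.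
suff -> : \row_j (map_mx phi (specvals A) 0 j * map_mx psi (specvals A) 0 j) =
  map_mx (fun x => phi x * psi x) (specvals A) by [].
by apply/matrixP => i j; rewrite !mxE !ord1.
Qed.

Lemma funcalc_cst n (r : R) (A : 'M[C]_n) : funcalc (fun=> r) A = r%:C%:M.
Proof.
rewrite funcalcE (_ : map_mx _ _ = const_mx r).
  by rewrite rdiag_const mul_mx_scalar -scalemxAl spectral_ctmxM scalemx1.
by apply/matrixP => i j; rewrite !mxE.
Qed.

Lemma scalar_mxC0 n : (0 : R)%:C%:M = 0 :> 'M[C]_n.
Proof. by rewrite -[RHS](raddf0 scalar_mx). Qed.

Lemma rdiag_specvals n (A : 'M[C]_n) : A^t* = A ->
  rdiag (specvals A) = spectralmx A *m A *m (spectralmx A)^t*.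
Proof.
move=> hA; rewrite {3}(spectralE hA) !mulmxA spectral_mulct mul1mx.
by rewrite -mulmxA spectral_mulct mulmx1.
Qed.

Lemma psd_diag_ge0 n (A : 'M[C]_n) i : psdmx A -> 0 <= A i i.
Proof.
case=> _ /(_ (delta_mx i 0)); rewrite trmx_delta map_delta_mx.
by rewrite -rowE -colE !mxE.
Qed.

(** An eigenvalue is a diagonal entry in the eigenbasis, and diagonal entries respect the Loewner
    order. *)
Lemma specvals_ge n (A : 'M[C]_n) (r : R) i :
  A^t* = A -> r%:C%:M ⊑ A -> r <= specvals A 0 i.
Proof.
move=> hA /(loewner_conj ((spectralmx A)^t*)); rewrite ctmxK -rdiag_specvals //.
rewrite mul_mx_scalar -scalemxAl spectral_mulct scalemx1 => /(psd_diag_ge0 i).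
by rewrite !mxE eqxx !mulr1n subr_ge0 lecR.
Qed.

Lemma specvals_le n (A : 'M[C]_n) (r : R) i :
  A^t* = A -> A ⊑ r%:C%:M -> specvals A 0 i <= r.
Proof.
move=> hA /(loewner_conj ((spectralmx A)^t*)); rewrite ctmxK -rdiag_specvals //.
rewrite mul_mx_scalar -scalemxAl spectral_mulct scalemx1 => /(psd_diag_ge0 i).
by rewrite !mxE eqxx !mulr1n subr_ge0 lecR.
Qed.

Lemma specvals_ge0 n (A : 'M[C]_n) i : psdmx A -> 0 <= specvals A 0 i.
Proof.
move=> hA; apply: specvals_ge (psd_herm hA) _.
by rewrite scalar_mxC0; rewrite loewner_ge0.
Qed.

Lemma psd_rdiag n (d : 'rV[R]_n) : (forall i, 0 <= d 0 i) -> psdmx (rdiag d).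
Proof.
move=> d0; apply: psdI => [|v]; first exact: ctmx_rdiag.
rewrite -mulmxA /rdiag mul_diag_mx mxE sumr_ge0 // => i _; rewrite !mxE.
by rewrite mulrCA mulr_ge0 ?ler0c ?d0 // mulrC mul_conjC_ge0.
Qed.

(** In the eigenbasis of [A] the difference is diagonal, with entries psi - phi at the
    eigenvalues. *)
Lemma funcalc_loewner n (phi psi : R -> R) (A : 'M[C]_n) :
  (forall i, phi (specvals A 0 i) <= psi (specvals A 0 i)) ->
  funcalc phi A ⊑ funcalc psi A.
Proof.
move=> h.
rewrite (funcalcE phi) (funcalcE psi).
apply: (@loewner_conj R n n _ _ (spectralmx A)).
rewrite /loewner_le /rdiag -raddfB /=.
rewrite (_ : _ - _ = map_mx (real_complex R)
  (map_mx psi (specvals A) - map_mx phi (specvals A))); last first.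
  by rewrite map_mxB.
by apply: psd_rdiag => i; move: (h i); rewrite !mxE subr_ge0.
Qed.

Lemma eq_funcalc n (phi psi : R -> R) (A : 'M[C]_n) :
  (forall i, phi (specvals A 0 i) = psi (specvals A 0 i)) ->
  funcalc phi A = funcalc psi A.
Proof.
move=> h; rewrite (funcalcE phi) (funcalcE psi).
suff -> : map_mx phi (specvals A) = map_mx psi (specvals A) by [].
by apply/matrixP => i j; move: (h j); rewrite !mxE ord1.
Qed.

Lemma ctmx_sqrtmx n (A : 'M[C]_n) : (sqrtmx A)^t* = sqrtmx A.
Proof. exact: ctmx_funcalc. Qed.

Lemma sqrtmxK n (A : 'M[C]_n) : psdmx A -> sqrtmx A *m sqrtmx A = A.
Proof.
move=> hA; rewrite /sqrtmx funcalcM -[RHS](funcalc_id (psd_herm hA)).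
by apply: eq_funcalc => i; rewrite -expr2 sqr_sqrtr // specvals_ge0.
Qed.

Lemma psd_bound n (A : 'M[C]_n) : psdmx A ->
  exists2 c : R, 0 < c & A ⊑ c%:C%:M.
Proof.
(* The added 1 keeps the bound positive when all eigenvalues vanish and in dimension 0. *)
move=> hA; exists (1 + \sum_i specvals A 0 i).
  by rewrite ltr_pwDl // sumr_ge0 // => i _; exact: specvals_ge0.
rewrite -{1}(funcalc_id (psd_herm hA)) -(funcalc_cst _ A).
apply: funcalc_loewner => i; rewrite (bigD1 i) //= addrCA lerDl addr_ge0 //.
by rewrite sumr_ge0 // => j _; exact: specvals_ge0.
Qed.

(** The spectral projections on the right do not depend on [phi]; a linear map therefore sends every
    phi(A) to a combination of the same matrices. *)
Lemma sumr_funcalc n (phi : R -> R) (A : 'M[C]_n) :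
  funcalc phi A = \sum_i (phi (specvals A 0 i))%:C *:
    ((spectralmx A)^t* *m delta_mx i i *m spectralmx A).
Proof.
rewrite funcalcE /rdiag diag_mx_sum_delta mulmx_sumr mulmx_suml.
by apply: eq_bigr => i _; rewrite !mxE -scalemxAr -scalemxAl.
Qed.

Lemma psd_spectral_proj n (A : 'M[C]_n) i :
  psdmx ((spectralmx A)^t* *m delta_mx i i *m spectralmx A).
Proof.
apply: psd_conj; have := psd_gram (delta_mx i i : 'M[C]_n).
by rewrite trmx_delta map_delta_mx mul_delta_mx.
Qed.

End FunctionalCalculus.

(** * Positive definite matrices, inverses, and exchanging the factors of a sandwich *)

Section PositiveDefinite.
Context {R : realType}.
Local Notation C := R[i].

(** An explicit scalar lower bound passes at once to larger matrices and bounds the eigenvalues away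
    from 0. *)
Definition pdmx n (A : 'M[C]_n) : Prop := exists2 e : R, 0 < e & e%:C%:M ⊑ A.

Lemma pd_psd n (A : 'M[C]_n) : pdmx A -> psdmx A.
Proof. by case=> e e0; apply: loewner_psd; apply: psd_scalar; exact: ltW. Qed.

Lemma pd_herm n (A : 'M[C]_n) : pdmx A -> A^t* = A.
Proof. by move=> /pd_psd; exact: psd_herm. Qed.

Lemma pd_loewner n (A B : 'M[C]_n) : pdmx A -> A ⊑ B -> pdmx B.
Proof. by case=> e e0 eA AB; exists e; [exact: e0|exact: loewner_trans AB]. Qed.

Lemma pd_scalar n (e : R) : 0 < e -> pdmx (e%:C%:M : 'M[C]_n).
Proof. by move=> e0; exists e; [exact: e0|exact: loewner_refl]. Qed.

Lemma pd_specvals n (A : 'M[C]_n) i : pdmx A -> 0 < specvals A 0 i.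
Proof.
by move=> hA; case: (hA) => e e0 eA; apply: lt_le_trans e0 (specvals_ge _ _ eA);
  exact: pd_herm.
Qed.

Lemma funcalcVK n (A : 'M[C]_n) : pdmx A -> funcalc GRing.inv A *m A = 1%:M.
Proof.
move=> hA; rewrite -{2}(funcalc_id (pd_herm hA)) funcalcM.
rewrite -[RHS](funcalc_cst 1 A); apply: eq_funcalc => i.
by rewrite mulVf // gt_eqF // pd_specvals.
Qed.

Lemma pd_unit n (A : 'M[C]_n) : pdmx A -> A \in unitmx.
Proof. by move=> /funcalcVK/mulmx1_unit[]. Qed.

Lemma invmx_funcalc n (A : 'M[C]_n) : pdmx A -> invmx A = funcalc GRing.inv A.
Proof.
move=> hA; have uA := pd_unit hA.
by rewrite -[RHS]mulmx1 -(mulmxV uA) mulmxA funcalcVK // mul1mx.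
Qed.

Lemma ctmx_invmx n (A : 'M[C]_n) : A^t* = A -> (invmx A)^t* = invmx A.
Proof. by move=> hA; rewrite trmx_inv map_invmx hA. Qed.

Lemma pd_funcalc n (phi : R -> R) (A : 'M[C]_n) :
  (forall i, 0 < phi (specvals A 0 i)) -> pdmx (funcalc phi A).
Proof.
(* Starting the minimum at 1 keeps it defined and positive in dimension 0. *)
move=> h; pose e := \big[Num.min/1]_i phi (specvals A 0 i).
exists e; first by rewrite /e; elim/big_ind: _ => // x y x0 y0; rewrite lt_min x0.
rewrite -(funcalc_cst _ A); apply: funcalc_loewner => i.
by rewrite /e (bigD1 i) //= ge_min lexx.
Qed.

Lemma pd_invmx n (A : 'M[C]_n) : pdmx A -> pdmx (invmx A).
Proof.
move=> hA; rewrite (invmx_funcalc hA); apply: pd_funcalc => i.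
by rewrite invr_gt0; exact: pd_specvals.
Qed.

Lemma pd_sqrtmx n (A : 'M[C]_n) : pdmx A -> pdmx (sqrtmx A).
Proof. by move=> hA; apply: pd_funcalc => i; rewrite sqrtr_gt0 pd_specvals. Qed.

Lemma scalar_le_invmx n (A : 'M[C]_n) (c : R) : pdmx A ->
  A ⊑ c%:C%:M -> c^-1%:C%:M ⊑ invmx A.
Proof.
move=> hA Ac; have hh := pd_herm hA.
rewrite (invmx_funcalc hA) -(funcalc_cst _ A); apply: funcalc_loewner => i.
have h := specvals_le i hh Ac; have h0 := pd_specvals i hA.
by rewrite lef_pV2 ?posrE // (lt_le_trans h0).
Qed.

(* [A^-1 - B^-1 = (A^-1 - B^-1) A (A^-1 - B^-1) + B^-1 (B - A) B^-1]. *)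
Lemma loewner_invmx n (A B : 'M[C]_n) : pdmx A -> A ⊑ B -> invmx B ⊑ invmx A.
Proof.
move=> hA AB; have hB := pd_loewner hA AB.
have uA := pd_unit hA; have uB := pd_unit hB.
have hVA := ctmx_invmx (pd_herm hA); have hVB := ctmx_invmx (pd_herm hB).
have h1 : psdmx ((invmx A - invmx B) *m A *m (invmx A - invmx B)).
  by apply: psd_conjH (pd_psd hA); rewrite ctmxB hVA hVB.
have h2 : psdmx (invmx B *m (B - A) *m invmx B) := psd_conjH hVB AB.
have := psdD h1 h2; rewrite /loewner_le; congr psdmx.
rewrite !(mulmxBl, mulmxBr) mulVmx // mulVmx // !mul1mx -[_ *m A *m invmx A]mulmxA.
rewrite mulmxV // mulmx1.
by move: (_ *m A *m _) => ?; move: (invmx A) (invmx B) => ? ?; mx_linear.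
Qed.

(** Put H = M M^t. Conjugating the hypothesis by M^t gives H^2 <= g H; adding (g - H)^2 >= 0 leaves
    g (g - H) >= 0. *)
Lemma gram_le n p (M : 'M[C]_(n, p)) (g : R) : 0 < g ->
  M^t* *m M ⊑ g%:C%:M -> M *m M^t* ⊑ g%:C%:M.
Proof.
move=> g0 /(loewner_conj (M^t*)); rewrite ctmxK /loewner_le.
have gV : 0 <= g^-1%:C :> C by rewrite ler0c invr_ge0 ltW.
have gg : g^-1%:C * g%:C = 1 :> C by rewrite -rmorphM /= mulVf // gt_eqF.
rewrite mul_mx_scalar -scalemxAl; set H := M *m M^t*.
rewrite (mulmxA M) -(mulmxA (M *m M^t*)) -/H => h.
have hH : H^t* = H by rewrite /H ctmxM ctmxK.
have := psdD h (psd_gram (g%:C%:M - H)); rewrite ctmxB hH ctmx_scalar.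
rewrite mulmxBl !mulmxBr !mul_mx_scalar !mul_scalar_mx => /(psdZ gV).
suff -> : g%:C%:M - H = g^-1%:C *: (g%:C *: (g%:C%:M - H)).
  set X := (X in psdmx (_ *: X)); suff -> : X = g%:C *: (g%:C%:M - H) by [].
  by rewrite /X; move: (H *m H) => {X h} HH; move: H hH g%:C%:M => ? _ ?; mx_linear.
by rewrite scalerA gg scale1r.
Qed.

Lemma herm_conj_leC n (S T : 'M[C]_n) (g : R) : S^t* = S -> T^t* = T -> 0 < g ->
  S *m (T *m T) *m S ⊑ g%:C%:M -> T *m (S *m S) *m T ⊑ g%:C%:M.
Proof.
move=> hS hT g0; have := @gram_le _ _ (T *m S) g g0.
by rewrite ctmxM hS hT !mulmxA.
Qed.

(** The two sandwiches are M^t M and M M^t for M = Y^(1/2) X^(1/2). The exchange moves the factor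
    under the root to the middle, where Loewner estimates apply directly. *)
Lemma sqrt_conj_leC n (X Y : 'M[C]_n) (g : R) : psdmx X -> psdmx Y -> 0 < g ->
  sqrtmx X *m Y *m sqrtmx X ⊑ g%:C%:M -> sqrtmx Y *m X *m sqrtmx Y ⊑ g%:C%:M.
Proof.
move=> hX hY g0; rewrite -{1}(sqrtmxK hY) -{3}(sqrtmxK hX).
exact: herm_conj_leC (ctmx_sqrtmx X) (ctmx_sqrtmx Y) g0.
Qed.

(** * The operator norm as the least scalar Loewner bound *)

Lemma l2normE n (v : 'cV[C]_n) : (l2norm v ^+ 2)%:C = (v^t* *m v) 0 0.
Proof.
rewrite /l2norm sqr_sqrtr ?sumr_ge0 // => [|i _]; last exact: sqr_ge0.
rewrite rmorph_sum mxE; apply: eq_bigr => i _; rewrite !mxE rmorphXn mulrC.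
by rewrite -normCK.
Qed.

Lemma l2norm_ge0 n (v : 'cV[C]_n) : 0 <= l2norm v.
Proof. exact: sqrtr_ge0. Qed.

Lemma l2norm0 n : l2norm (0 : 'cV[C]_n) = 0.
Proof.
by apply/eqP; rewrite -sqrf_eq0 -(inj_eq (@complexI R)) l2normE mulmx0 mxE.
Qed.

Lemma l2norm_psd_le n (M : 'M[C]_n) (g : R) (v : 'cV[C]_n) :
  psdmx M -> 0 <= g -> M ⊑ g%:C%:M -> l2norm v <= 1 -> l2norm (M *m v) <= g.
Proof.
move=> hM g0 Mg v1; rewrite -(@ler_pXn2r _ 2) ?nnegrE ?l2norm_ge0 //.
rewrite -lecR l2normE ctmxM psd_herm // mulmxA -[_ *m M *m M]mulmxA.
(* The squared norm of M v is the quadratic form of M^2 at v, and M^2 <= g^2 because the eigenvalues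
   lie in [0, g]. *)
have MM : M *m M ⊑ (g ^+ 2)%:C%:M.
  rewrite -(funcalc_id (psd_herm hM)) funcalcM -(funcalc_cst _ M).
  apply: funcalc_loewner => i; rewrite -expr2 ler_pXn2r ?nnegrE ?specvals_ge0 //.
  exact: specvals_le (psd_herm hM) Mg.
have := MM.2 v; rewrite mulmxBr mulmxBl mxE [X in _ + X]mxE subr_ge0.
move=> /le_trans; apply; rewrite mul_mx_scalar -scalemxAl mxE -l2normE -rmorphM /=.
by rewrite lecR ler_piMr ?sqr_ge0 // expr_le1 ?l2norm_ge0.
Qed.

Lemma opnorm_psd_le n (M : 'M[C]_n) (g : R) :
  psdmx M -> 0 <= g -> M ⊑ g%:C%:M -> opnorm M <= g.
Proof.
move=> hM g0 Mg; apply: ge_sup => [|_ [v v1 <-]]; last exact: l2norm_psd_le.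
by exists (l2norm (M *m 0)), 0 => //=; rewrite l2norm0.
Qed.

Lemma opnorm_psd_ubound n (M : 'M[C]_n) (v : 'cV[C]_n) :
  psdmx M -> l2norm v <= 1 -> l2norm (M *m v) <= opnorm M.
Proof.
move=> hM v1; have [c c0 Mc] := psd_bound hM; apply: ub_le_sup; last by exists v.
by exists c => _ [w w1 <-]; apply: l2norm_psd_le => //; exact: ltW.
Qed.

Lemma opnorm_psd_ge0 n (M : 'M[C]_n) : psdmx M -> 0 <= opnorm M.
Proof.
move=> hM; apply: le_trans (l2norm_ge0 (M *m 0)) _.
by apply: opnorm_psd_ubound; rewrite ?l2norm0.
Qed.

Lemma psd_le_opnorm n (M : 'M[C]_n) : psdmx M -> M ⊑ (opnorm M)%:C%:M.
Proof.
move=> hM; have hh := psd_herm hM.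
rewrite -{1}(funcalc_id hh) -(funcalc_cst _ M); apply: funcalc_loewner => i /=.
(* A unit eigenvector for the i-th eigenvalue: the norm of M v is that eigenvalue, so the operator
   norm dominates it. *)
set U := spectralmx M; pose v : 'cV[C]_n := U^t* *m delta_mx i 0.
have vv : v^t* *m v = 1%:M.
  rewrite /v ctmxM ctmxK mulmxA -[_ *m U *m _]mulmxA spectral_mulct mulmx1.
  rewrite trmx_delta map_delta_mx mul_delta_mx; apply/matrixP => a b.
  by rewrite !mxE !ord1.
have Mv : M *m v = (specvals M 0 i)%:C *: v.
  rewrite {1}(spectralE hh) /v !mulmxA -[_ *m U *m _]mulmxA spectral_mulct mulmx1.
  rewrite -mulmxA scalemxAr; apply: congr1; rewrite /rdiag mul_diag_mx.
  apply/matrixP => a b; rewrite mxE [RHS]mxE.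
  by rewrite [delta_mx _ _ _ _]mxE !mxE; case: eqP => [->|]; rewrite ?mulr0.
have v1 : l2norm v = 1.
  apply/eqP; rewrite -(@eqrXn2 _ 2) ?l2norm_ge0 // expr1n.
  by rewrite -(inj_eq (@complexI R)) l2normE vv mxE eqxx.
have := @opnorm_psd_ubound _ M v hM; rewrite v1 lexx => /(_ isT).
suff -> : l2norm (M *m v) = specvals M 0 i by [].
apply/eqP; rewrite -(@eqrXn2 _ 2) ?l2norm_ge0 ?specvals_ge0 //.
rewrite -(inj_eq (@complexI R)) l2normE Mv ctmxZ -scalemxAl -scalemxAr vv.
by rewrite !mxE eqxx mulr1 conj_realC rmorphXn expr2.
Qed.

(** Replaces norms by scalar Loewner bounds. A positive [g] and a slack [e] are all that the
    regularized argument has to handle. *)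
Lemma opnorm_psd_le_max n (S S0 S1 : 'M[C]_n) :
  psdmx S -> psdmx S0 -> psdmx S1 ->
  (forall g e, 0 < g -> 0 < e -> S0 ⊑ g%:C%:M -> S1 ⊑ g%:C%:M ->
    S ⊑ (g + e)%:C%:M) ->
  opnorm S <= Num.max (opnorm S0) (opnorm S1).
Proof.
move=> hS hS0 hS1; have := psd_le_opnorm hS0; have := psd_le_opnorm hS1.
have := opnorm_psd_ge0 hS0; move: (opnorm S0) (opnorm S1) => g0 g1 g0p h1 h0 h.
apply/ler_addgt0Pr => e e0; have e2 : 0 < e / 2 by rewrite divr_gt0.
(* Half of the error makes the common bound positive even if both norms vanish; the other half is
   the slack. *)
have gp : 0 < Num.max g0 g1 + e / 2 by rewrite ltr_wpDl // le_max g0p.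
have G0 : g0 <= Num.max g0 g1 + e / 2 by apply: ler_wpDr; [exact: ltW|rewrite le_max lexx].
have G1 : g1 <= Num.max g0 g1 + e / 2 by apply: ler_wpDr; [exact: ltW|rewrite le_max lexx orbT].
rewrite (splitr e) addrA; apply: (opnorm_psd_le hS); first by rewrite addr_ge0 // ltW.
apply: h gp e2 _ _.
  exact: loewner_trans h0 (loewner_scalar n G0).
exact: loewner_trans h1 (loewner_scalar n G1).
Qed.

End PositiveDefinite.

(** * The operator Jensen inequality *)

Section Jensen.
Context {R : realType}.
Local Notation C := R[i].

(* Unlike [operator_monotone], this also applies to the adjoint function, whose
   value at 0 is a limit. *)
Definition pd_operator_monotone (g : R -> R) : Prop :=
  forall (k : nat) (A B : 'M[C]_k),
    pdmx A -> A ⊑ B -> funcalc g A ⊑ funcalc g B.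

(** Used with c = 1 + d and with c = 1, [P] being a projection there. *)
Lemma affine_conj n (c : C) (P T : 'M[C]_n) :
  (c *: P - 1%:M) *m T *m (c *: P - 1%:M) =
  c ^+ 2 *: (P *m T *m P) - c *: (P *m T) - c *: (T *m P) + T.
Proof.
rewrite mulmxBl mul1mx -scalemxAl mulmxBr mulmx1 mulmxBl -!scalemxAl -!scalemxAr.
move: (P *m T *m P) (P *m T) (T *m P) => X Y Z.
by mx_linear.
Qed.

(** With P = V V^t and E = (1 + d) P - 1, right side minus left side is the sum of V (Q - (1 + d)
    V^t T V) V^t, d^-1 E T E and (1 + d^-1) (1 - P) (tau - T) (1 - P), each positive semidefinite.
    The term with E absorbs the off-diagonal blocks of T. *)
Lemma loewner_dilation n p (T : 'M[C]_n) (V : 'M[C]_(n, p)) (Q : 'M[C]_p)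
    (tau d : R) :
  V^t* *m V = 1%:M -> T ⊑ tau%:C%:M -> psdmx T -> 0 < d ->
  (1 + d)%:C *: (V^t* *m T *m V) ⊑ Q ->
  T ⊑ V *m Q *m V^t* + ((1 + d^-1) * tau)%:C *: (1%:M - V *m V^t*).
Proof.
move=> hV hT T0 d0 hQ; set P := V *m V^t*.
have hP : P^t* = P by rewrite /P ctmxM ctmxK.
have PP : P *m P = P by rewrite /P mulmxA -(mulmxA V) hV mulmx1.
have hP' : (1%:M - P)^t* = 1%:M - P by rewrite ctmxB ctmx1 hP.
have hE : ((1 + d)%:C *: P - 1%:M)^t* = (1 + d)%:C *: P - 1%:M.
  by rewrite ctmxB ctmxZ ctmx1 hP conj_realC.
have e0 : 0 <= d^-1%:C :> C by rewrite ler0c invr_ge0 ltW.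
have e1 : 0 <= (1 + d^-1)%:C :> C.
  by rewrite ler0c addr_ge0 // invr_ge0 ltW.
have h1 := psdZ e0 (psd_conjH hE T0).
have h2 := psdZ e1 (psd_conjH hP' hT).
have := loewner_conj (V^t*) hQ; rewrite ctmxK /loewner_le => h3.
have := psdD h3 (psdD h1 h2).
set X := (X in psdmx X); set Y := (Y in _ -> psdmx Y).
suff -> : X = Y by [].
rewrite {}/X {}/Y -scalemxAr -scalemxAl.
rewrite (_ : V *m (V^t* *m T *m V) *m V^t* = P *m T *m P); last by rewrite /P !mulmxA.
have dn : d%:C != 0 :> C by rewrite (inj_eq (@complexI R) d 0) gt_eqF.
rewrite affine_conj (_ : 1%:M - P = - (1 *: P - 1%:M)); last by mx_linear.
rewrite mulNmx mulmxN mulNmx opprK affine_conj.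
rewrite (_ : P *m (_ - T) *m P = tau%:C *: P - P *m T *m P); last first.
  by rewrite mulmxBr mulmxBl mul_mx_scalar -scalemxAl PP.
rewrite mulmxBr mulmxBl mul_mx_scalar mul_scalar_mx -[tau%:C%:M]scalemx1.
have -> : d^-1%:C = (d%:C)^-1 :> C by rewrite fmorphV.
have -> : ((1 + d^-1) * tau)%:C = (1 + (d%:C)^-1) * tau%:C :> C.
  by rewrite rmorphM rmorphD fmorphV rmorph1.
have -> : (1 + d)%:C = 1 + d%:C :> C by rewrite rmorphD rmorph1.
have -> : (1 + d^-1)%:C = 1 + (d%:C)^-1 :> C by rewrite rmorphD fmorphV rmorph1.
move: (P *m T *m P) (V *m Q *m _) (P *m T) (T *m P) => PTP VQV PT TP.
clear h1 h2 h3 hP PP hP' hE; move: P 1%:M => P I1.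
move: {e0 e1 hQ hT d0} (d%:C : C) (tau%:C : C) dn => {}d {}tau dn.
apply/matrixP => a b; rewrite ?(mxDE, mxNE, mxZE).
by field.
Qed.

Lemma jensen_isometry n p (g : R -> R) (T : 'M[C]_n) (V : 'M[C]_(n, p))
    (Q : 'M[C]_p) (d : R) :
  pd_operator_monotone g -> pdmx T -> V^t* *m V = 1%:M -> 0 < d ->
  (1 + d)%:C *: (V^t* *m T *m V) ⊑ Q -> V^t* *m funcalc g T *m V ⊑ funcalc g Q.
Proof.
move=> hg hT hV d0 hQ; have T0 := pd_psd hT.
have [tau tau0 Ttau] := psd_bound T0.
have := loewner_dilation hV Ttau T0 d0 hQ; set S := (X in T ⊑ X) => TS.
have c0 : 0 <= (1 + d)%:C :> C by rewrite ler0c addr_ge0 // ltW.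
have hQ0 : psdmx Q by exact: loewner_psd (psdZ c0 (psd_conj V T0)) hQ.
have hS := pd_herm (pd_loewner hT TS).
(* The correction term disappears because (1 - V V^t) V = 0. *)
have SV : S *m V = V *m Q.
  rewrite /S mulmxDl -scalemxAl mulmxBl mul1mx -!mulmxA hV !mulmx1.
  by rewrite subrr scaler0 addr0.
have gSV := funcalc_intertwine g hS (psd_herm hQ0) SV.
have := loewner_conj V (hg _ _ _ hT TS).
by rewrite -[X in _ ⊑ X]mulmxA gSV (mulmxA (V^t*) V) hV mul1mx.
Qed.

Lemma pd_rdiag n (d : 'rV[R]_n) : (forall i, 0 < d 0 i) -> pdmx (rdiag d).
Proof.
move=> d0; pose e := \big[Num.min/1]_i d 0 i.
exists e; first by rewrite /e; elim/big_ind: _ => // x y x0 y0; rewrite lt_min x0.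
have : psdmx (rdiag (d - const_mx e)).
  apply: psd_rdiag => i; rewrite !mxE subr_ge0.
  by rewrite /e (bigD1 i) //= ge_min lexx.
by rewrite /loewner_le -rdiag_const /rdiag map_mxB raddfB.
Qed.

(** Stacking the roots D_i^(1/2) in one column gives an isometry, since V^t V = sum_i D_i = 1. It
    compresses the block diagonal matrix with scalar blocks u_i to sum_i u_i D_i. *)
Lemma jensen_partition k l (g : R -> R) (t : 'I_k -> R) (D : 'I_k -> 'M[C]_l)
    (Q : 'M[C]_l) (d : R) :
  pd_operator_monotone g -> (forall i, 0 < t i) -> (forall i, psdmx (D i)) ->
  \sum_i D i = 1%:M -> 0 < d -> (1 + d)%:C *: \sum_i (t i)%:C *: D i ⊑ Q ->
  \sum_i (g (t i))%:C *: D i ⊑ funcalc g Q.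
Proof.
move=> hg t0 D0 D1 d0 hQ.
pose V : 'M[C]_(\sum_(i < k) l, l) := \mxcol_i sqrtmx (D i).
have Vt : V^t* = \mxrow_i sqrtmx (D i).
  rewrite /V tr_mxcol; apply/matrixP => a b; rewrite [in RHS]mxE !mxE.
  by have /matrixP/(_ a (tagnat.sig2 b)) := ctmx_sqrtmx (D (tagnat.sig1 b)); rewrite !mxE.
pose r (u : 'I_k -> R) : 'rV[R]_(\sum_(i < k) l) := \mxrow_i const_mx (u i).
have VrV u : V^t* *m rdiag (r u) *m V = \sum_i (u i)%:C *: D i.
  have -> : rdiag (r u) = \mxdiag_(i < k) ((u i)%:C%:M : 'M[C]_l).
    rewrite -(eq_mxdiag (fun i => rdiag_const l (u i))) /rdiag -diag_mxrow.
    by apply: congr1; apply/matrixP => a b; rewrite !mxE.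
  rewrite -mulmxA mul_mxdiag_mxcol Vt mul_mxrow_mxcol; apply: eq_bigr => i _.
  by rewrite mul_scalar_mx -scalemxAr (sqrtmxK (D0 i)).
have VV : V^t* *m V = 1%:M.
  by rewrite Vt mul_mxrow_mxcol -D1; apply: eq_bigr => i _; exact: sqrtmxK (D0 i).
rewrite -(VrV (g \o t)); rewrite -(VrV t) in hQ.
have -> : r (g \o t) = map_mx g (r t) by apply/matrixP => a b; rewrite !mxE.
rewrite -funcalc_rdiag; apply: jensen_isometry hg _ VV d0 hQ.
by apply: pd_rdiag => i; rewrite !mxE.
Qed.

(* The defect [1 - \sum_i D i] is added to the family with a small weight. *)
Lemma jensen_operator k l (g : R -> R) (t : 'I_k -> R) (D : 'I_k -> 'M[C]_l)
    (Q : 'M[C]_l) (e : R) :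
  pd_operator_monotone g -> (forall x, 0 < x -> 0 <= g x) ->
  (forall i, 0 < t i) -> (forall i, psdmx (D i)) -> \sum_i D i ⊑ 1%:M ->
  0 < e -> \sum_i (t i)%:C *: D i + e%:C%:M ⊑ Q ->
  \sum_i (g (t i))%:C *: D i ⊑ funcalc g Q.
Proof.
move=> hg g0 t0 D0 D1 e0 hQ.
have tD0 : psdmx (\sum_i (t i)%:C *: D i).
  by apply: psd_sum => i; apply: psdZ (D0 i); rewrite ler0c ltW.
have [y y0 hy] := psd_bound tD0.
pose D' i := if unlift ord0 i is Some j then D j else 1%:M - \sum_i D i.
(* Both excess terms come to e / 2: d y = e / 2 for the dilation factor, and (1 + d) s = e / 2 for
   the point [s] attached to the defect. *)
pose d := e / (2 * y); pose s := e / (2 * (1 + d)).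
have d0 : 0 < d by rewrite divr_gt0 // mulr_gt0.
have s0 : 0 < s by rewrite divr_gt0 // mulr_gt0 // addr_gt0.
pose t' i := if unlift (ord0 : 'I_k.+1) i is Some j then t j else s.
have sumE (h : R -> R) : \sum_i (h (t' i))%:C *: D' i =
    (h s)%:C *: (1%:M - \sum_i D i) + \sum_i (h (t i))%:C *: D i.
  rewrite big_ord_recl /t' /D' unlift_none; apply: congr1.
  by apply: eq_bigr => i _; rewrite liftK.
have hD' i : psdmx (D' i) by rewrite /D'; case: unliftP => [j _|_]; [exact: D0|exact: D1].
have ht' i : 0 < t' i by rewrite /t'; case: unliftP.
have sumD' : \sum_i D' i = 1%:M.
  rewrite big_ord_recl /D' unlift_none -[RHS](subrK (\sum_i D i)).
  by apply: congr1; apply: eq_bigr => i _; rewrite liftK.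
have hQ' : (1 + d)%:C *: \sum_i (t' i)%:C *: D' i ⊑ Q.
  rewrite (sumE id); apply: loewner_trans hQ; set Y := \sum_i _ *: _ in tD0 hy *.
  have hs : 0 <= ((1 + d) * s)%:C :> C by rewrite ler0c mulr_ge0 ?addr_ge0 // ltW.
  have hd : 0 <= d%:C :> C by rewrite ler0c ltW.
  have h1 : 1%:M - \sum_i D i ⊑ 1%:M.
    by rewrite /loewner_le opprB addrCA subrr addr0; exact: psd_sum.
  have := loewnerD (loewner_refl Y) (loewnerD (loewnerZ hd hy) (loewnerZ hs h1)).
  rewrite (_ : Y + (_ + _ *: 1%:M) = Y + e%:C%:M); last first.
    rewrite !scale_scalar_mx mulr1 -raddfD /= -!rmorphM -rmorphD /=.
    have -> // : d * y + (1 + d) * s = e.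
    rewrite /s; have : 1 + d != 0 by rewrite gt_eqF // addr_gt0.
    move: (1 + d) => d1 dn; rewrite /d; field.
    by rewrite dn gt_eqF.
  suff -> : Y + (d%:C *: Y + ((1 + d) * s)%:C *: (1%:M - \sum_i D i)) =
    (1 + d)%:C *: (s%:C *: (1%:M - \sum_i D i) + Y) by [].
  have -> : ((1 + d) * s)%:C = (1 + d)%:C * s%:C :> C by exact: rmorphM.
  have -> : (1 + d)%:C = 1 + d%:C :> C by exact: rmorphD.
  move: (1%:M - _) Y {tD0 hy} (d%:C : C) (s%:C : C) {hd hs} => ? ? ? ?.
  by mx_linear.
have := jensen_partition hg ht' hD' sumD' d0 hQ'.
rewrite sumE; apply: loewner_trans.
(* The contribution g(s) (1 - sum_i D_i) of the defect is positive semidefinite and is dropped. *)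
rewrite /loewner_le addrK; apply: psdZ; first by rewrite ler0c g0.
exact: D1.
Qed.

End Jensen.

(** * Monotonicity of scalar means and of the adjoint function *)

Section Means.
Context {R : realType}.
Local Notation C := R[i].

Lemma loewner_scalar1 (x y : R) : (x%:C%:M : 'M[C]_1) ⊑ y%:C%:M -> x <= y.
Proof. by move=> /(psd_diag_ge0 0); rewrite !mxE eqxx !mulr1n subr_ge0 lecR. Qed.

Lemma pd_operator_monotone_homo (g : R -> R) (x y : R) :
  pd_operator_monotone g -> 0 < x -> x <= y -> g x <= g y.
Proof.
move=> hg x0 xy; apply: loewner_scalar1.
by have := hg 1%N _ _ (pd_scalar 1 x0) (loewner_scalar 1 xy); rewrite !funcalc_scalar.
Qed.

Lemma pd_operator_monotone_ratio (g : R -> R) (q t : R) :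
  pd_operator_monotone g -> (forall x, 0 < x -> 0 <= g x) ->
  0 < q -> q <= t -> q * g t <= t * g q.
Proof.
move=> hg g0 q0 qt; have t0 := lt_le_trans q0 qt.
(* Jensen with the single point t and weight c = (q - e) / t <= 1: as t c + e = q, it gives c g(t)
   <= g(q). *)
have step e : 0 < e -> e < q -> (q - e) * g t <= t * g q.
  move=> e0 eq0; pose c := (q - e) / t.
  have c0 : 0 <= c by rewrite divr_ge0 ?subr_ge0 // ltW.
  have hc : \sum_(i < 1) c%:C%:M ⊑ (1%:M : 'M[C]_1).
    rewrite big_ord1; apply: (@loewner_scalar R 1 c 1).
    by rewrite ler_pdivrMr // mul1r lerBlDr (le_trans qt) // lerDl ltW.
  have hQ : \sum_(i < 1) t%:C *: c%:C%:M + e%:C%:M ⊑ (q%:C%:M : 'M[C]_1).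
    rewrite big_ord1 scale_scalar_mx -rmorphM -raddfD /= -rmorphD /=.
    have -> : t * c + e = q by rewrite /c mulrC divfK ?gt_eqF // subrK.
    exact: loewner_refl.
  have := @jensen_operator R 1 1 g (fun=> t) (fun=> c%:C%:M) _ e
    hg g0 (fun=> t0) (fun=> psd_scalar 1 c0) hc e0 hQ.
  rewrite big_ord1 scale_scalar_mx -rmorphM funcalc_scalar => /loewner_scalar1.
  by rewrite /c mulrA ler_pdivrMr // mulrC [g q * t]mulrC.
apply/ler_addgt0Pr => e e0; have gt0 := g0 t t0.
(* The first term ensures e' < q, the second e' g(t) <= e; the 1 in the denominator covers g(t) =
   0. *)
pose e' := Num.min (q / 2) (e / (g t + 1)).
have gt1 : 0 < g t + 1 by rewrite ltr_wpDl.
have e'0 : 0 < e' by rewrite lt_min !divr_gt0.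
have e'q : e' < q by rewrite gt_min ltr_pdivrMr // ltr_pMr // ltr1n.
have := step e' e'0 e'q; rewrite mulrBl lerBlDr => /le_trans; apply; rewrite lerD2l.
have : e' <= e / (g t + 1) by rewrite ge_min lexx orbT.
rewrite ler_pdivlMr // mulrDr mulr1; apply: le_trans.
by rewrite lerDl ltW.
Qed.

(** First a grows: monotonicity of t / g(t) between b / a' and b / a, scaled by a a' / b, gives a
    g(b / a) <= a' g(b / a'). Then b grows, by monotonicity of g. *)
Lemma perspective_homo (g : R -> R) (a a' b b' : R) :
  pd_operator_monotone g -> (forall x, 0 < x -> 0 <= g x) ->
  0 < a -> a <= a' -> 0 < b -> b <= b' -> a * g (b / a) <= a' * g (b' / a').
Proof.
move=> hg g0 a0 aa' b0 bb'; have a'0 := lt_le_trans a0 aa'.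
apply: (@le_trans _ _ (a' * g (b / a'))); last first.
  rewrite ler_pM2l //; apply: pd_operator_monotone_homo hg _ _; first by rewrite divr_gt0.
  by rewrite ler_pM2r // invr_gt0.
have h : b / a' <= b / a by rewrite ler_pM2l // lef_pV2.
have := pd_operator_monotone_ratio hg g0 (divr_gt0 b0 a'0) h.
rewrite -(@ler_pM2l _ (a * a' / b)); last by rewrite divr_gt0 ?mulr_gt0.
rewrite !mulrA; congr (_ * _ <= _ * _); field; rewrite ?gt_eqF //.
Qed.

(** The expression is nondecreasing in eps and bounded below by 0, so its limit at 0 from the right
    is its infimum over eps > 0. *)
Lemma mean_fun_bounds (g phi0 phi1 : R -> R) (x : R) :
  pd_operator_monotone g -> (forall y, 0 < y -> 0 <= g y) ->
  0 <= phi0 x -> 0 <= phi1 x ->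
  0 <= mean_fun g phi0 phi1 x /\
  forall e, 0 < e -> mean_fun g phi0 phi1 x <=
    (phi0 x + e) * g ((phi1 x + e) / (phi0 x + e)).
Proof.
move=> hg g0 p0 p1; rewrite /mean_fun.
set F := fun eps : R => _ * _.
pose I := [set` `]0, +oo[%R]%classic : set R.
have Fpos e : 0 < e -> 0 <= F e.
  by move=> e0; rewrite mulr_ge0 ?addr_ge0 ?g0 ?divr_gt0 ?ltr_wpDl // ltW.
have lbF : has_lbound (F @` I)%classic.
  by exists 0 => _ [e + <-]; rewrite /I /= in_itv /= andbT; exact: Fpos.
have cvF : (F e @[e --> (0 : R)^'+] --> inf (F @` I))%classic.
  apply: nondecreasing_at_right_cvgr => //.
  move=> r s; rewrite !in_itv /= !andbT => r0 s0 rs.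
  by apply: perspective_homo; rewrite ?lerD2l // ltr_wpDl.
rewrite (cvg_lim _ cvF) //; split=> [|e e0].
  apply: lb_le_inf; first by exists (F 1), 1 => //; rewrite /I /= in_itv /= ltr01.
  by move=> _ [e + <-]; rewrite /I /= in_itv /= andbT; exact: Fpos.
by apply: ge_inf => //; exists e => //; rewrite /I /= in_itv /= e0.
Qed.

Lemma operator_monotone_pd (f : R -> R) :
  operator_monotone f -> pd_operator_monotone f.
Proof.
move=> hf k A B hA AB; have A0 := pd_psd hA.
exact: hf A0 (loewner_psd A0 AB) AB.
Qed.

(** Comparison with the point 1: f(x) >= 1 for x >= 1 by monotonicity, and f(x) >= x for x < 1 by
    monotonicity of t / f(t). *)
Lemma OM1_gt0 (f : R -> R) (x : R) : OM1 f -> 0 < x -> 0 < f x.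
Proof.
case=> f0 /operator_monotone_pd hf f1 x0.
have [x1|x1] := leP 1 x.
  by apply: lt_le_trans (pd_operator_monotone_homo hf ltr01 x1); rewrite f1.
have := pd_operator_monotone_ratio hf (fun y y0 => f0 y (ltW y0)) x0 (ltW x1).
by rewrite f1 mulr1 mul1r; exact: lt_le_trans.
Qed.

Lemma funcalc_adjoint n (f : R -> R) (A : 'M[C]_n) : OM1 f -> pdmx A ->
  funcalc (adjoint_fun f) A = invmx (funcalc f (invmx A)).
Proof.
move=> hf hA; have hV := pd_invmx hA.
have hfV : pdmx (funcalc f (invmx A)).
  by apply: pd_funcalc => i; apply: OM1_gt0 hf _; exact: pd_specvals.
rewrite (invmx_funcalc hfV) (invmx_funcalc hA) funcalc_comp funcalc_comp.
by apply: eq_funcalc => i; rewrite /adjoint_fun (pd_specvals _ hA).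
Qed.

(** On positive definite matrices the adjoint is inversion, then f, then inversion; the two order
    reversals cancel. *)
Lemma adjoint_pd_operator_monotone (f : R -> R) :
  OM1 f -> pd_operator_monotone (adjoint_fun f).
Proof.
move=> hf k A B hA AB; have hB := pd_loewner hA AB.
rewrite (funcalc_adjoint hf hA) (funcalc_adjoint hf hB); apply: loewner_invmx.
  by apply: pd_funcalc => i; apply: OM1_gt0 hf _; apply: pd_specvals; exact: pd_invmx.
case: hf => _ /operator_monotone_pd hf _; apply: hf; first exact: pd_invmx.
exact: loewner_invmx hA AB.
Qed.

Lemma adjoint_ge0 (f : R -> R) (x : R) : OM1 f -> 0 < x -> 0 <= adjoint_fun f x.
Proof.
move=> hf x0; rewrite /adjoint_fun x0 invr_ge0 ltW //; apply: OM1_gt0 hf _.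
by rewrite invr_gt0.
Qed.

End Means.

(** * Sandwich inequalities for weighted sums of positive semidefinite matrices *)

Section SandwichBounds.
Context {R : realType}.
Local Notation C := R[i].

Lemma conjVK n (S Y : 'M[C]_n) : S \in unitmx ->
  invmx S *m (S *m Y *m S) *m invmx S = Y.
Proof. by move=> uS; rewrite -!mulmxA mulmxV // mulmx1 mulKmx. Qed.

Lemma conjKV n (S Y : 'M[C]_n) : S \in unitmx ->
  S *m (invmx S *m Y *m invmx S) *m S = Y.
Proof. by move=> uS; rewrite -!mulmxA mulVmx // mulmx1 mulKVmx. Qed.

Lemma invmx_sq n (S : 'M[C]_n) : S \in unitmx ->
  invmx (S *m S) = invmx S *m invmx S.
Proof.
move=> uS; have u2 : S *m S \in unitmx by rewrite unitmx_mul uS.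
by rewrite -[RHS](mulKmx u2) -(mulmxA S S) (mulKVmx uS) (mulmxV uS) mulmx1.
Qed.

Lemma herm_conj_le_inv n (S Y : 'M[C]_n) (g : R) : S \in unitmx -> S^t* = S ->
  S *m Y *m S ⊑ g%:C%:M -> Y ⊑ g%:C *: invmx (S *m S).
Proof.
move=> uS hS /(loewner_conjH (ctmx_invmx hS)).
by rewrite (conjVK _ uS) mul_mx_scalar -scalemxAl (invmx_sq uS).
Qed.

Lemma sqrt_conj_le_inv n (X Y : 'M[C]_n) (g : R) : pdmx X ->
  sqrtmx X *m Y *m sqrtmx X ⊑ g%:C%:M -> Y ⊑ g%:C *: invmx X.
Proof.
move=> hX; rewrite -{3}(sqrtmxK (pd_psd hX)).
exact: herm_conj_le_inv (pd_unit (pd_sqrtmx hX)) (ctmx_sqrtmx X).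
Qed.

(** The middle factor shrinks directly; the outer one shrinks after [sqrt_conj_leC] has moved it to
    the middle. *)
Lemma sqrt_conj_mono n (X Y X' Y' : 'M[C]_n) (g : R) :
  psdmx X -> psdmx X' -> psdmx Y -> 0 < g -> X' ⊑ X -> Y' ⊑ Y ->
  sqrtmx X *m Y *m sqrtmx X ⊑ g%:C%:M ->
  sqrtmx X' *m Y' *m sqrtmx X' ⊑ g%:C%:M.
Proof.
move=> X0 X'0 Y0 g0 XX YY h.
apply: loewner_trans (loewner_conjH (ctmx_sqrtmx X') YY) _.
apply: (sqrt_conj_leC Y0 X'0 g0).
apply: loewner_trans (loewner_conjH (ctmx_sqrtmx Y) XX) _.
exact: sqrt_conj_leC X0 Y0 g0 h.
Qed.

Lemma sqrt_conj_scalar n (X : 'M[C]_n) (t : R) : psdmx X ->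
  sqrtmx X *m t%:C%:M *m sqrtmx X = t%:C *: X.
Proof. by move=> hX; rewrite mul_mx_scalar -scalemxAl (sqrtmxK hX). Qed.

Lemma sqrt_conj_shift n (X Y X' : 'M[C]_n) (g t y : R) :
  psdmx X -> psdmx Y -> psdmx X' -> 0 < g -> 0 < t -> 0 < y ->
  X' ⊑ X + t%:C%:M -> Y ⊑ y%:C%:M ->
  sqrtmx X *m Y *m sqrtmx X ⊑ g%:C%:M ->
  sqrtmx X' *m Y *m sqrtmx X' ⊑ (g + t * y)%:C%:M.
Proof.
move=> X0 Y0 X'0 g0 t0 y0 XX Yy h.
have gg : 0 < g + t * y by rewrite addr_gt0 ?mulr_gt0.
have t0' : 0 <= t%:C :> C by rewrite ler0c ltW.
apply: (sqrt_conj_leC Y0 X'0 gg).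
apply: loewner_trans (loewner_conjH (ctmx_sqrtmx Y) XX) _.
rewrite mulmxDr mulmxDl (sqrt_conj_scalar _ Y0).
have := loewnerD (sqrt_conj_leC X0 Y0 g0 h) (loewnerZ t0' Yy).
suff -> : g%:C%:M + t%:C *: y%:C%:M = (g + t * y)%:C%:M :> 'M[C]_n by [].
by rewrite scale_scalar_mx -rmorphM -raddfD /= -rmorphD.
Qed.

(** Enlarging the outer factor by t costs t Y <= t y in the exchanged form; enlarging the middle one
    then costs t X' <= t (x + t). *)
Lemma sqrt_conj_shift2 n (X Y X' Y' : 'M[C]_n) (g t y x : R) :
  psdmx X -> psdmx Y -> psdmx X' -> 0 < g -> 0 < t -> 0 < y ->
  X' ⊑ X + t%:C%:M -> Y' ⊑ Y + t%:C%:M -> Y ⊑ y%:C%:M -> X ⊑ x%:C%:M ->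
  sqrtmx X *m Y *m sqrtmx X ⊑ g%:C%:M ->
  sqrtmx X' *m Y' *m sqrtmx X' ⊑ (g + t * (x + y + t))%:C%:M.
Proof.
move=> X0 Y0 X'0 g0 t0 y0 XX YY Yy Xx h.
have t0' : 0 <= t%:C :> C by rewrite ler0c ltW.
apply: loewner_trans (loewner_conjH (ctmx_sqrtmx X') YY) _.
rewrite mulmxDr mulmxDl (sqrt_conj_scalar _ X'0).
have X'x : X' ⊑ (x + t)%:C%:M.
  have := loewner_trans XX (loewnerD Xx (loewner_refl t%:C%:M)).
  by rewrite -raddfD /= -rmorphD.
have := loewnerD (sqrt_conj_shift X0 Y0 X'0 g0 t0 y0 XX Yy h) (loewnerZ t0' X'x).
suff -> : (g + t * y)%:C%:M + t%:C *: (x + t)%:C%:M =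
  (g + t * (x + y + t))%:C%:M :> 'M[C]_n by [].
rewrite scale_scalar_mx -rmorphM -raddfD /= -rmorphD /=.
suff -> : g + t * y + t * (x + t) = g + t * (x + y + t) by [].
by ring.
Qed.

(** For J = S^-1 G S^-1 the hypotheses say Z <= J^-1 and W <= g J. The first gives J^(1/2) Z J^(1/2)
    <= 1, hence Z^(1/2) J Z^(1/2) <= 1 by exchange, and the second finishes. *)
Lemma sqrt_conj_dual n (Z W S G : 'M[C]_n) (g : R) :
  S \in unitmx -> S^t* = S -> pdmx G -> psdmx Z -> psdmx W -> 0 < g ->
  invmx S *m Z *m invmx S ⊑ invmx G -> g^-1%:C *: (S *m W *m S) ⊑ G ->
  sqrtmx Z *m W *m sqrtmx Z ⊑ g%:C%:M.
Proof.
move=> uS hS hG Z0 W0 g0 hZ hW; have hV := ctmx_invmx hS; have uG := pd_unit hG.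
have g0' : 0 <= g%:C :> C by rewrite ler0c ltW.
have gg : g%:C * g^-1%:C = 1 :> C by rewrite -rmorphM /= mulfV // gt_eqF.
have := loewner_conjH hS hZ; rewrite (conjKV _ uS) => {}hZ.
have := loewnerZ g0' (loewner_conjH hV hW).
rewrite -scalemxAr -scalemxAl (conjVK _ uS) scalerA gg scale1r => {}hW.
pose J := invmx S *m G *m invmx S; have J0 : psdmx J := psd_conjH hV (pd_psd hG).
have JH : J *m (S *m invmx G *m S) = 1%:M.
  by rewrite /J -!mulmxA mulKmx // mulKVmx // mulVmx.
have hJ : sqrtmx J *m (S *m invmx G *m S) *m sqrtmx J = 1%:M.
  apply: (@mulmx1C _ _ (sqrtmx J)).
  by rewrite (mulmxA (sqrtmx J) (sqrtmx J)) (sqrtmxK J0).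
have h1 : sqrtmx J *m Z *m sqrtmx J ⊑ 1%:C%:M.
  by have := loewner_conjH (ctmx_sqrtmx J) hZ; rewrite hJ.
have := sqrt_conj_leC J0 Z0 ltr01 h1 => /(loewnerZ g0').
rewrite scale_scalar_mx mulr1; apply: loewner_trans.
rewrite scalemxAl scalemxAr.
exact: loewner_conjH (ctmx_sqrtmx Z) hW.
Qed.

Lemma wsum_psd n k (a : 'I_k -> R) (E : 'I_k -> 'M[C]_n) :
  (forall i, 0 <= a i) -> (forall i, psdmx (E i)) ->
  psdmx (\sum_i (a i)%:C *: E i).
Proof. by move=> a0 E0; apply: psd_sum => i; apply: psdZ (E0 i); rewrite ler0c. Qed.

Lemma wsum_loewner n k (a b : 'I_k -> R) (E : 'I_k -> 'M[C]_n) :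
  (forall i, a i <= b i) -> (forall i, psdmx (E i)) ->
  \sum_i (a i)%:C *: E i ⊑ \sum_i (b i)%:C *: E i.
Proof.
move=> ab E0; rewrite /loewner_le -sumrB; apply: psd_sum => i.
by rewrite -scalerBl -rmorphB; apply: psdZ (E0 i); rewrite ler0c subr_ge0.
Qed.

Lemma wsum_conj n k (s t : 'I_k -> R) (r : C) (S : 'M[C]_n) (E : 'I_k -> 'M[C]_n) :
  \sum_i (s i)%:C *: (r *: (S *m ((t i)%:C *: E i) *m S)) =
  r *: (S *m (\sum_i (t i * s i)%:C *: E i) *m S).
Proof.
rewrite mulmx_sumr mulmx_suml scaler_sumr; apply: eq_bigr => i _.
rewrite -!scalemxAr -!scalemxAl !scalerA; congr (_ *: _).
by rewrite rmorphM; ring.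
Qed.

(** Jensen at the points b_i / a_i with weights D_i = r a_i S E_i S. It serves twice: for the
    adjoint with S^-1 and r = 1, and for f with S and r = g^-1. *)
Lemma jensen_conj l k (g : R -> R) (a b : 'I_k -> R) (E : 'I_k -> 'M[C]_l)
    (S Q : 'M[C]_l) (r e : R) :
  pd_operator_monotone g -> (forall x, 0 < x -> 0 <= g x) ->
  (forall i, 0 < a i) -> (forall i, 0 < b i) -> (forall i, psdmx (E i)) ->
  S^t* = S -> 0 <= r -> 0 < e ->
  r%:C *: (S *m (\sum_i (a i)%:C *: E i) *m S) ⊑ 1%:M ->
  r%:C *: (S *m (\sum_i (b i)%:C *: E i) *m S) + e%:C%:M ⊑ Q ->
  r%:C *: (S *m (\sum_i (a i * g (b i / a i))%:C *: E i) *m S) ⊑ funcalc g Q.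
Proof.
move=> hg g0 a0 b0 E0 hS r0 e0 ha hb.
pose D i := r%:C *: (S *m ((a i)%:C *: E i) *m S).
have D0 i : psdmx (D i).
  apply: psdZ; first by rewrite ler0c.
  by apply: psd_conjH hS _; apply: psdZ (E0 i); rewrite ler0c ltW.
have t0 i : 0 < b i / a i by rewrite divr_gt0.
have hD : \sum_i D i ⊑ 1%:M.
  suff -> : \sum_i D i = r%:C *: (S *m (\sum_i (a i)%:C *: E i) *m S) by exact: ha.
  by rewrite mulmx_sumr mulmx_suml scaler_sumr.
have hQ : \sum_i (b i / a i)%:C *: D i + e%:C%:M ⊑ Q.
  have -> : \sum_i (b i / a i)%:C *: D i =
      r%:C *: (S *m (\sum_i (a i * (b i / a i))%:C *: E i) *m S).
    exact: (wsum_conj (fun i => b i / a i)).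
  suff -> : \sum_i (a i * (b i / a i))%:C *: E i = \sum_i (b i)%:C *: E i by exact: hb.
  by apply: eq_bigr => i _; rewrite mulrC divfK // gt_eqF.
by have := jensen_operator hg g0 t0 D0 hD e0 hQ; rewrite (wsum_conj (fun i => g (b i / a i))).
Qed.

Lemma wsumD_scalar_le n k (a : 'I_k -> R) (E : 'I_k -> 'M[C]_n) (e x : R) :
  0 < e -> \sum_i E i ⊑ x%:C%:M ->
  \sum_i (a i + e)%:C *: E i + e%:C%:M ⊑
  \sum_i (a i)%:C *: E i + (e * (x + 1))%:C%:M.
Proof.
move=> e0 hE; have e0' : 0 <= e%:C :> C by rewrite ler0c ltW.
have := loewnerD (loewner_refl (\sum_i (a i)%:C *: E i + e%:C%:M)) (loewnerZ e0' hE).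
have -> : \sum_i (a i)%:C *: E i + e%:C%:M + e%:C *: \sum_i E i =
    \sum_i (a i + e)%:C *: E i + e%:C%:M.
  rewrite addrAC scaler_sumr -big_split; apply: (congr1 (fun X => X + _)).
  by apply: eq_bigr => i _; rewrite rmorphD scalerDl.
suff -> : \sum_i (a i)%:C *: E i + e%:C%:M + e%:C *: x%:C%:M =
    \sum_i (a i)%:C *: E i + (e * (x + 1))%:C%:M by [].
rewrite scale_scalar_mx -rmorphM -addrA -raddfD /= -rmorphD /=.
suff -> : e + e * x = e * (x + 1) by [].
by ring.
Qed.

Lemma sqrt_conj_means_pd l n m (f : R -> R) (E : 'I_n -> 'M[C]_l)
    (F : 'I_m -> 'M[C]_l) (a b : 'I_n -> R) (c d : 'I_m -> R) (e g : R) :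
  OM1 f -> (forall i, psdmx (E i)) -> (forall j, psdmx (F j)) ->
  (forall i, 0 < a i) -> (forall i, 0 < b i) ->
  (forall j, 0 < c j) -> (forall j, 0 < d j) -> 0 < e -> 0 < g ->
  let X0 := \sum_i (a i)%:C *: E i + e%:C%:M in
  let X1 := \sum_i (b i)%:C *: E i + e%:C%:M in
  let Y0 := \sum_j (c j)%:C *: F j + e%:C%:M in
  let Y1 := \sum_j (d j)%:C *: F j + e%:C%:M in
  let Z := \sum_i (a i * adjoint_fun f (b i / a i))%:C *: E i in
  let W := \sum_j (c j * f (d j / c j))%:C *: F j in
  sqrtmx X0 *m Y0 *m sqrtmx X0 ⊑ g%:C%:M ->
  sqrtmx X1 *m Y1 *m sqrtmx X1 ⊑ g%:C%:M ->
  sqrtmx Z *m W *m sqrtmx Z ⊑ g%:C%:M.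
Proof.
move=> hf E0 F0 a0 b0 c0 d0 e0 g0 X0 X1 Y0 Y1 Z W h0 h1.
have eX0 : e%:C%:M ⊑ X0.
  by rewrite /loewner_le addrK; apply: wsum_psd E0 => i; exact: ltW.
have eX1 : e%:C%:M ⊑ X1.
  by rewrite /loewner_le addrK; apply: wsum_psd E0 => i; exact: ltW.
have pX0 : pdmx X0 by exists e; [exact: e0|exact: eX0].
have pX1 : pdmx X1 by exists e; [exact: e0|exact: eX1].
have aX0 : \sum_i (a i)%:C *: E i ⊑ X0.
  by rewrite /loewner_le addrC addKr; apply: psd_scalar; exact: ltW.
have cY0 : \sum_j (c j)%:C *: F j ⊑ Y0.
  by rewrite /loewner_le addrC addKr; apply: psd_scalar; exact: ltW.
have {}h1 := sqrt_conj_le_inv pX1 h1.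
have := ctmx_sqrtmx X0; have := pd_unit (pd_sqrtmx pX0); have := sqrtmxK (pd_psd pX0).
(* From here on [S] is any invertible Hermitian matrix with S S = X0. *)
move: (sqrtmx X0) h0 => S h0 SS uS hS; have hV := ctmx_invmx hS.
have [x x0 hx] := psd_bound (pd_psd pX0).
have xX0 : x^-1%:C%:M ⊑ invmx S *m invmx S.
  by rewrite -(invmx_sq uS) SS; exact: scalar_le_invmx pX0 hx.
have e0' : 0 <= e%:C :> C by rewrite ler0c ltW.
have gV0 : 0 <= g^-1 by rewrite invr_ge0 ltW.
have gV0' : 0 <= g^-1%:C :> C by rewrite ler0c.
have gg : g^-1%:C * g%:C = 1 :> C by rewrite -rmorphM /= mulVf // gt_eqF.
pose Q := invmx S *m X1 *m invmx S.
(* Conjugation by S^-1 turns the margin e contained in X1 into e X0^-1 >= e / x. This supplies the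
   strict slack that Jensen's inequality asks for. *)
have exQ (Y : 'M[C]_l) : Y + e%:C%:M ⊑ X1 ->
    invmx S *m Y *m invmx S + (e * x^-1)%:C%:M ⊑ Q.
  move=> /(loewner_conjH hV); rewrite mulmxDr mulmxDl mul_mx_scalar -scalemxAl.
  apply: loewner_trans; apply: loewnerD; first exact: loewner_refl.
  by have := loewnerZ e0' xX0; rewrite scale_scalar_mx -rmorphM.
have ex0 : 0 < e * x^-1 by rewrite divr_gt0.
have pQ : pdmx Q.
  exists (e * x^-1); first exact: ex0.
  by have := exQ 0; rewrite mulmx0 mul0mx !add0r; apply.
have QV : invmx Q = S *m invmx X1 *m S.
  have uX1 := pd_unit pX1; have uQ := pd_unit pQ.
  rewrite -[RHS](mulKmx uQ) (_ : Q *m _ = 1%:M) ?mulmx1 //.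
  by rewrite /Q -!mulmxA (mulKmx uS) (mulKVmx uX1) (mulVmx uS).
have pG : pdmx (funcalc f (invmx Q)).
  by apply: pd_funcalc => i; apply: OM1_gt0 hf _; apply: pd_specvals; exact: pd_invmx.
have Z0 : psdmx Z.
  apply: wsum_psd E0 => i; apply: mulr_ge0; first exact: ltW.
  by apply: adjoint_ge0 hf _; rewrite divr_gt0.
have W0 : psdmx W.
  apply: wsum_psd F0 => i; apply: mulr_ge0; apply: ltW; first exact: c0.
  by apply: OM1_gt0 hf _; rewrite divr_gt0.
have hZ : invmx S *m Z *m invmx S ⊑ invmx (funcalc f (invmx Q)).
  rewrite -(funcalc_adjoint hf pQ).
  have ha : 1%:C *: (invmx S *m (\sum_i (a i)%:C *: E i) *m invmx S) ⊑ 1%:M.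
    rewrite scale1r; have := loewner_conjH hV aX0.
    by rewrite -SS (mulKmx uS) (mulmxV uS).
  have hb : 1%:C *: (invmx S *m (\sum_i (b i)%:C *: E i) *m invmx S)
      + (e * x^-1)%:C%:M ⊑ Q.
    by rewrite scale1r; apply: exQ; exact: loewner_refl.
  have := jensen_conj (adjoint_pd_operator_monotone hf)
    (fun y => @adjoint_ge0 R f y hf) a0 b0 E0 hV ler01 ex0 ha hb.
  by rewrite scale1r.
have hW : g^-1%:C *: (S *m W *m S) ⊑ funcalc f (invmx Q).
  have hfp := hf; case: hfp => _ /operator_monotone_pd hfm _.
  have hc : g^-1%:C *: (S *m (\sum_j (c j)%:C *: F j) *m S) ⊑ 1%:M.
    have := loewnerZ gV0' (loewner_trans (loewner_conjH hS cY0) h0).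
    by rewrite -[g%:C%:M]scalemx1 scalerA gg scale1r.
  (* The slack on the other side: the margin e in Y1 becomes g^-1 e S S = g^-1 e X0, and X0 >= e. *)
  have e2 : 0 < g^-1 * (e * e) by rewrite !mulr_gt0 ?invr_gt0.
  have hd : g^-1%:C *: (S *m (\sum_j (d j)%:C *: F j) *m S)
      + (g^-1 * (e * e))%:C%:M ⊑ invmx Q.
    have := loewnerZ gV0' (loewner_conjH hS h1).
    rewrite -scalemxAr -scalemxAl scalerA gg scale1r -QV; apply: loewner_trans.
    rewrite /Y1 mulmxDr mulmxDl scalerDr; apply: loewnerD; first exact: loewner_refl.
    rewrite mul_mx_scalar -scalemxAl SS.
    have := loewnerZ gV0' (loewnerZ e0' eX0).
    by rewrite !scale_scalar_mx -!rmorphM.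
  exact: jensen_conj hfm (fun y y0 => ltW (OM1_gt0 hf y0)) c0 d0 F0 hS gV0 e2 hc hd.
exact: sqrt_conj_dual uS hS pG Z0 W0 g0 hZ hW.
Qed.

(** All weights and the four sums are raised by e, at cost at most eta. The positive definite case
    then bounds the regularized means, which dominate [z] and [w], and [sqrt_conj_mono] returns to
    these. *)
Lemma sqrt_conj_means l n m (f : R -> R) (E : 'I_n -> 'M[C]_l)
    (F : 'I_m -> 'M[C]_l) (a b z : 'I_n -> R) (c d w : 'I_m -> R) (g eta : R) :
  OM1 f -> (forall i, psdmx (E i)) -> (forall j, psdmx (F j)) ->
  (forall i, 0 <= a i) -> (forall i, 0 <= b i) -> (forall i, 0 <= z i) ->
  (forall j, 0 <= c j) -> (forall j, 0 <= d j) -> (forall j, 0 <= w j) ->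
  (forall i e, 0 < e -> z i <= (a i + e) * adjoint_fun f ((b i + e) / (a i + e))) ->
  (forall j e, 0 < e -> w j <= (c j + e) * f ((d j + e) / (c j + e))) ->
  0 < g -> 0 < eta ->
  let X0 := \sum_i (a i)%:C *: E i in let X1 := \sum_i (b i)%:C *: E i in
  let Y0 := \sum_j (c j)%:C *: F j in let Y1 := \sum_j (d j)%:C *: F j in
  let Z := \sum_i (z i)%:C *: E i in let W := \sum_j (w j)%:C *: F j in
  sqrtmx X0 *m Y0 *m sqrtmx X0 ⊑ g%:C%:M ->
  sqrtmx X1 *m Y1 *m sqrtmx X1 ⊑ g%:C%:M ->
  sqrtmx Z *m W *m sqrtmx Z ⊑ (g + eta)%:C%:M.
Proof.
move=> hf E0 F0 a0 b0 z0 c0 d0 w0 hz hw g0 eta0 X0 X1 Y0 Y1 Z W h0 h1.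
have X0p : psdmx X0 := wsum_psd a0 E0; have X1p : psdmx X1 := wsum_psd b0 E0.
have Y0p : psdmx Y0 := wsum_psd c0 F0; have Y1p : psdmx Y1 := wsum_psd d0 F0.
have [xX0 xX0p hX0] := psd_bound X0p; have [xX1 xX1p hX1] := psd_bound X1p.
have [yY0 yY0p hY0] := psd_bound Y0p; have [yY1 yY1p hY1] := psd_bound Y1p.
have [xE xEp hE] := psd_bound (psd_sum E0); have [xF xFp hF] := psd_bound (psd_sum F0).
(* M bounds x + y for either pair of sums, and K bounds sum_i E_i and sum_j F_j. Raising by e costs
   at most e (K + 1) = t in each sum; since t <= 1, the sandwich grows by at most t (M + 1) <=
   eta. *)
pose M := xX0 + xX1 + yY0 + yY1; pose K := xE + xF.
pose t := Num.min 1 (eta / (M + 1)); pose e := t / (K + 1).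
have M0 : 0 < M by rewrite !addr_gt0.
have K0 : 0 < K by rewrite addr_gt0.
have t0 : 0 < t by rewrite lt_min ltr01 divr_gt0 ?addr_gt0.
have e0 : 0 < e by rewrite divr_gt0 ?addr_gt0.
have shift k (h : 'I_k -> R) (G : 'I_k -> 'M[C]_l) (u : R) : u <= K ->
    \sum_i G i ⊑ u%:C%:M ->
    \sum_i (h i + e)%:C *: G i + e%:C%:M ⊑ \sum_i (h i)%:C *: G i + t%:C%:M.
  move=> uK hG; apply: loewner_trans (wsumD_scalar_le h e0 hG) _.
  apply: loewnerD; first exact: loewner_refl.
  apply: loewner_scalar; rewrite /e mulrAC ler_pdivrMr ?addr_gt0 //.
  by rewrite ler_pM2l // lerD2r.
have xK : xE <= K by rewrite lerDl ltW.
have yK : xF <= K by rewrite lerDr ltW.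
have reg (h : 'I_n -> R) (h' : 'I_m -> R) (X := \sum_i (h i)%:C *: E i)
    (Y := \sum_j (h' j)%:C *: F j) (x y : R) :
    (forall i, 0 <= h i) -> (forall j, 0 <= h' j) -> 0 < x -> 0 < y ->
    x + y <= M -> X ⊑ x%:C%:M -> Y ⊑ y%:C%:M ->
    sqrtmx X *m Y *m sqrtmx X ⊑ g%:C%:M ->
    sqrtmx (\sum_i (h i + e)%:C *: E i + e%:C%:M)
      *m (\sum_j (h' j + e)%:C *: F j + e%:C%:M)
      *m sqrtmx (\sum_i (h i + e)%:C *: E i + e%:C%:M) ⊑ (g + eta)%:C%:M.
  move=> hp hp' x0 y0 xyM hX hY hXY.
  have X'p : psdmx (\sum_i (h i + e)%:C *: E i + e%:C%:M).
    apply: psdD; last by apply: psd_scalar; exact: ltW.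
    by apply: wsum_psd E0 => i; rewrite addr_ge0 // ltW.
  have := sqrt_conj_shift2 (wsum_psd hp E0) (wsum_psd hp' F0) X'p g0 t0 y0
    (shift _ h E _ xK hE) (shift _ h' F _ yK hF) hY hX hXY.
  move=> /loewner_trans; apply; apply: loewner_scalar; rewrite lerD2l.
  apply: (@le_trans _ _ (t * (M + 1))).
    by rewrite ler_pM2l // lerD // /t ge_min lexx.
  by rewrite -ler_pdivlMr ?addr_gt0 // /t ge_min lexx orbT.
have M0' : xX0 + yY0 <= M.
  by rewrite /M; lra.
have M1' : xX1 + yY1 <= M.
  by rewrite /M; lra.
have r0 := reg a c _ _ a0 c0 xX0p yY0p M0' hX0 hY0 h0.
have r1 := reg b d _ _ b0 d0 xX1p yY1p M1' hX1 hY1 h1.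
have ge0 : 0 < g + eta by rewrite addr_gt0.
have pos k (h : 'I_k -> R) : (forall i, 0 <= h i) -> forall i, 0 < h i + e.
  by move=> hh i; rewrite ltr_wpDl.
have h := sqrt_conj_means_pd hf E0 F0 (pos _ _ a0) (pos _ _ b0) (pos _ _ c0)
  (pos _ _ d0) e0 ge0 r0 r1.
have hze i := hz i e e0; have hwe j := hw j e e0.
have Zr := wsum_psd (fun i => le_trans (z0 i) (hze i)) E0.
have Wr := wsum_psd (fun j => le_trans (w0 j) (hwe j)) F0.
exact: sqrt_conj_mono Zr (wsum_psd z0 E0) Wr ge0
  (wsum_loewner hze E0) (wsum_loewner hwe F0) h.
Qed.

End SandwichBounds.

(** * Reduction of the norm inequality to weighted sums *)

Theorem proposition2p1 (R : realType) (n m l : nat)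
  (Phi : {linear 'M[R[i]]_n -> 'M[R[i]]_l})
  (Psi : {linear 'M[R[i]]_m -> 'M[R[i]]_l})
  (hPhi : positive_map Phi) (hPsi : positive_map Psi)
  (f : R -> R) (hf : OM1 f)
  (phi0 phi1 : R -> R)
  (hphi0 : forall x, 0 <= x -> 0 <= phi0 x)
  (hphi1 : forall x, 0 <= x -> 0 <= phi1 x) :
  let phi := mean_fun f phi0 phi1 in
  let phit := mean_fun (adjoint_fun f) phi0 phi1 in
  forall (A : 'M[R[i]]_n) (B : 'M[R[i]]_m), psdmx A -> psdmx B ->
    opnorm (sqrtmx (Phi (funcalc phit A)) *m Psi (funcalc phi B)
            *m sqrtmx (Phi (funcalc phit A)))
    <= Num.max
         (opnorm (sqrtmx (Phi (funcalc phi0 A)) *m Psi (funcalc phi0 B)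
                  *m sqrtmx (Phi (funcalc phi0 A))))
         (opnorm (sqrtmx (Phi (funcalc phi1 A)) *m Psi (funcalc phi1 B)
                  *m sqrtmx (Phi (funcalc phi1 A)))).
Proof.
move=> phi phit A B hA hB.
pose P i := (spectralmx A)^t* *m delta_mx i i *m spectralmx A.
pose Q j := (spectralmx B)^t* *m delta_mx j j *m spectralmx B.
have E0 i : psdmx (Phi (P i)) := hPhi _ (psd_spectral_proj A i).
have F0 j : psdmx (Psi (Q j)) := hPsi _ (psd_spectral_proj B j).
(* The same matrices Phi(P_i) serve all of [phi0], [phi1] and [phit]; only the scalar weights
   change. *)
have PhiE h : Phi (funcalc h A) = \sum_i (h (specvals A 0 i))%:C *: Phi (P i).
  rewrite sumr_funcalc linear_sum; apply: eq_bigr => i _; exact: linearZ.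
have PsiE h : Psi (funcalc h B) = \sum_j (h (specvals B 0 j))%:C *: Psi (Q j).
  rewrite sumr_funcalc linear_sum; apply: eq_bigr => i _; exact: linearZ.
have sA i : 0 <= specvals A 0 i := specvals_ge0 i hA.
have sB j : 0 <= specvals B 0 j := specvals_ge0 j hB.
have f0 x : 0 < x -> 0 <= f x by move=> x0; exact: ltW (OM1_gt0 hf x0).
have fpd : pd_operator_monotone f by case: (hf) => _ /operator_monotone_pd.
have fAbounds i := mean_fun_bounds (adjoint_pd_operator_monotone hf)
  (fun y => @adjoint_ge0 R f y hf) (hphi0 _ (sA i)) (hphi1 _ (sA i)).
have fBbounds j := mean_fun_bounds fpd f0 (hphi0 _ (sB j)) (hphi1 _ (sB j)).
have sandwich_psd h k : (forall i, 0 <= h (specvals A 0 i)) ->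
    (forall j, 0 <= k (specvals B 0 j)) ->
    psdmx (sqrtmx (Phi (funcalc h A)) *m Psi (funcalc k B)
            *m sqrtmx (Phi (funcalc h A))).
  move=> h0 k0; apply: psd_conjH (ctmx_sqrtmx _) _.
  by rewrite PsiE; exact: wsum_psd k0 F0.
have S0 := sandwich_psd phi0 phi0 (fun i => hphi0 _ (sA i)) (fun j => hphi0 _ (sB j)).
have S1 := sandwich_psd phi1 phi1 (fun i => hphi1 _ (sA i)) (fun j => hphi1 _ (sB j)).
have S := sandwich_psd phit phi (fun i => (fAbounds i).1) (fun j => (fBbounds j).1).
apply: (opnorm_psd_le_max S S0 S1) => g e gp ep h0 h1.
rewrite (PhiE phi0) (PsiE phi0) in h0; rewrite (PhiE phi1) (PsiE phi1) in h1.
rewrite (PhiE phit) (PsiE phi).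
apply: (sqrt_conj_means (a := fun i => phi0 (specvals A 0 i))
  (b := fun i => phi1 (specvals A 0 i)) (c := fun j => phi0 (specvals B 0 j))
  (d := fun j => phi1 (specvals B 0 j)) hf E0 F0 _ _ _ _ _ _ _ _ gp ep h0 h1).
- by move=> i; exact: hphi0.
- by move=> i; exact: hphi1.
- by move=> i; exact: (fAbounds i).1.
- by move=> i; exact: hphi0.
- by move=> i; exact: hphi1.
- by move=> i; exact: (fBbounds i).1.
- by move=> i; exact: (fAbounds i).2.
- by move=> i; exact: (fBbounds i).2.
Qed.
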